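(* Let $G=\ast_{\alpha\in A}G_\alpha$ be the free product of the groups $G_\alpha$ ($\alpha\in A$), let $H\le G$ be a subgroup, and let $\{D_\alpha,T_\alpha\mid\alpha\in A\}$ be a Kurosh system for $H\le G$. Fix $\alpha_0\in A$, let $$Z=\{z_{i,\alpha}\mid i\in I,\ \alpha\in A,\ z_{i,\alpha}\ne 1\},\qquad z_{i,\alpha}=\alpha(H_i)\alpha_0(H_i)^{-1}\in H,$$ and $F=\langle Z\rangle\le H$. Then $$H=\ast_{\alpha\in A}\Big[\ast_{u\in D_\alpha}\big(uG_\alpha u^{-1}\cap H\big)\Big]\ast F$$ (i.e. $H$ is the internal free product of the subgroups $uG_\alpha u^{-1}\cap H$, indexed by all pairs $(\alpha,u)$ with $\alpha\in A$, $u\in D_\alpha$, together with $F$), and $F$ is a free group with basis $Z$.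
   Context: Syllables: each non-trivial $g\in G=\ast_{\alpha\in A}G_\alpha$ is uniquely $g=g_1\cdots g_m$ with each $g_i$ a non-trivial element of some $G_\alpha$ and consecutive $g_i,g_{i+1}$ lying in different factors; $\ell(g)=m$ is the syllable length, $\ell(1)=0$, and if $g_m\in G_\alpha$ one says that $g$ ends in the syllable $\alpha$ (or that its last syllable is in $G_\alpha$). For $S\subseteq G$, $\ell(S)$ is the smallest syllable length of an element of $S$. Let $\{H_i\mid i\in I\}$ be the set of right cosets of $H$ in $G$, with a symbol $1\in I$ such that $H_1=H$. For each $\alpha\in A$ let $T_\alpha$ be a transversal of the right cosets of $H$ in $G$, and write $\alpha(H_i)$ for the representative of $H_i$ in $T_\alpha$; it is required that $\alpha(H)=1$ for all $\alpha\in A$. For each $\alpha$ let $D_\alpha$ be a system of representatives of the double cosets $H\backslash G/G_\alpha$, and write $\alpha(HgG_\alpha)\in D_\alpha$ for the representative of $HgG_\alpha$. The collection $\{D_\alpha,T_\alpha\mid\alpha\in A\}$ is a Kurosh system for $H\le G$ if for all $\alpha\in A$, $g\in G$, $i\in I$: (i) if $g=\alpha(HgG_\alpha)$, then $g=\alpha(Hg)$; (ii) $\alpha(HgG_\alpha)$ is either $1$ or ends in a syllable $\beta\ne\alpha$; (iii) if $H_i\subseteq HgG_\alpha$ and $\alpha(HgG_\alpha)=g$, then $\alpha(H_i)\in gG_\alpha$; (iv) if $1\ne g=\alpha(HgG_\alpha)$ has last syllable in $G_\beta$, then $\beta(Hg)=g$; (v) $\ell(\alpha(HgG_\alpha))=\ell(HgG_\alpha)$.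 *)

(* Defs.v *)
(* Groups may be infinite.  A [groupType] carries a choice structure, which is
   no restriction under the classical axioms of [boolp]. *)
From mathcomp Require Export all_boot.
From mathcomp Require Export boolp classical_sets.

Set Implicit Arguments.
Unset Strict Implicit.
Unset Printing Implicit Defensive.

Local Open Scope classical_set_scope.
Local Open Scope group_scope.

Definition is_subgroup (G : groupType) (K : set G) : Prop :=
  group_closed (mem K).

Definition generated (G : groupType) (Z : set G) : set G :=
  smallest (@is_subgroup G) Z.

(* A word over a family S of subsets records each syllable together with the
   index of its factor, so that "different factors" means different indices,
   even when two members of the family coincide as sets. *)
Definition reduced (G : groupType) (J : Type) (S : J -> set G)
    (w : seq (J * G)) : bool :=
  all (fun p => (p.2 \in S p.1) && (p.2 != 1)) w
  && sorted (fun p q => `[< p.1 <> q.1 >]) w.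

Definition normal_form (G : groupType) (J : Type) (S : J -> set G)
    (g : G) (w : seq (J * G)) : Prop :=
  reduced S w /\ \prod_(p <- w) p.2 = g.

(* K is the internal free product of the family S of its subgroups. *)
Definition free_product (G : groupType) (J : Type) (K : set G)
    (S : J -> set G) : Prop :=
  [/\ is_subgroup K,
      forall j, is_subgroup (S j) /\ S j `<=` K &
      forall g, K g -> exists! w, normal_form S g w].

(* The letter (z, true) stands for z and (z, false) for its inverse. *)
Definition free_word (G : groupType) (Z : set G) (w : seq (G * bool)) : bool :=
  all (fun p => p.1 \in Z) w && sorted (fun p q => q != (p.1, ~~ p.2)) w.

Definition free_word_value (G : groupType) (w : seq (G * bool)) : G :=
  \prod_(p <- w) (if p.2 then p.1 else p.1^-1).

Definition free_with_basis (G : groupType) (F Z : set G) : Prop :=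
  [/\ is_subgroup F, Z `<=` F &
      forall g, F g -> exists! w, free_word Z w /\ free_word_value w = g].

(* The default value 0 is irrelevant when G is the free product of S. *)
Definition syllable_length (G : groupType) (J : Type) (S : J -> set G)
    (g : G) : nat :=
  xget 0 [set n | exists2 w, normal_form S g w & size w = n].

Definition ends_in (G : groupType) (J : Type) (S : J -> set G)
    (g : G) (j : J) : Prop :=
  exists w x, normal_form S g (rcons w (j, x)).

(* The default value 0 is irrelevant when X is nonempty. *)
Definition set_syllable_length (G : groupType) (J : Type) (S : J -> set G)
    (X : set G) : nat :=
  xget 0 [set n | (exists2 x, X x & syllable_length S x = n)
                  /\ forall x, X x -> n <= syllable_length S x].

Definition right_coset (G : groupType) (H : set G) (g : G) : set G :=
  [set h * g | h in H].

Definition left_coset (G : groupType) (g : G) (K : set G) : set G :=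
  [set g * k | k in K].

Definition double_coset (G : groupType) (H : set G) (g : G) (K : set G)
    : set G :=
  [set h * g * k | h in H & k in K].

Definition right_cosets (G : groupType) (H : set G) : set (set G) :=
  [set right_coset H g | g in [set: G]].

Definition double_cosets (G : groupType) (H K : set G) : set (set G) :=
  [set double_coset H g K | g in [set: G]].

Definition conj_subset (G : groupType) (u : G) (K : set G) : set G :=
  [set u * k * u^-1 | k in K].

(* R contains exactly one element of each block; used only for blocks that
   partition G. *)
Definition representatives (G : groupType) (blocks : set (set G)) (R : set G)
    : Prop :=
  forall X, blocks X -> exists! r, R r /\ X r.

Definition rep (G : groupType) (R X : set G) : G := xget 1 (R `&` X).

(* The right cosets themselves serve as the index set I: an index i is
   replaced by the coset H_i. *)
Record kurosh_system (G : groupType) (A : Type) (Gf : A -> set G) (H : set G)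
    (D T : A -> set G) : Prop := KuroshSystem {
  kurosh_T : forall a, representatives (right_cosets H) (T a);
  kurosh_T1 : forall a, rep (T a) H = 1;
  kurosh_D : forall a, representatives (double_cosets H (Gf a)) (D a);
  kurosh_i : forall a g,
    g = rep (D a) (double_coset H g (Gf a)) ->
    g = rep (T a) (right_coset H g);
  kurosh_ii : forall a g,
    rep (D a) (double_coset H g (Gf a)) = 1 \/
    exists2 b, b <> a & ends_in Gf (rep (D a) (double_coset H g (Gf a))) b;
  kurosh_iii : forall a g Hi,
    right_cosets H Hi ->
    Hi `<=` double_coset H g (Gf a) ->
    rep (D a) (double_coset H g (Gf a)) = g ->
    left_coset g (Gf a) (rep (T a) Hi);
  kurosh_iv : forall a b g,
    1 <> g -> g = rep (D a) (double_coset H g (Gf a)) ->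
    ends_in Gf g b ->
    rep (T b) (right_coset H g) = g;
  kurosh_v : forall a g,
    syllable_length Gf (rep (D a) (double_coset H g (Gf a))) =
    set_syllable_length Gf (double_coset H g (Gf a))
}.

Definition kurosh_z (G : groupType) (A : Type) (T : A -> set G) (a0 : A)
    (Hi : set G) (a : A) : G :=
  rep (T a) Hi * (rep (T a0) Hi)^-1.

(* A set, not a family: distinct pairs (Hi, a) may give the same element. *)
Definition kurosh_Z (G : groupType) (A : Type) (H : set G) (T : A -> set G)
    (a0 : A) : set G :=
  [set z | z <> 1 /\
    exists2 Hi, right_cosets H Hi & exists a, z = kurosh_z T a0 Hi a].

(* The pair (a, u) with u in D a indexes the subgroup (u G_a u^-1) `&` H; the
   extra index None stands for the factor F. *)
Definition kurosh_factor (G : groupType) (A : Type) (Gf : A -> set G)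
    (H : set G) (D : A -> set G) (F : set G)
    (j : option {a : A & set_type (D a)}) : set G :=
  match j with
  | Some (existT a u) => conj_subset (val u) (Gf a) `&` H
  | None => F
  end.

(* Main.v *)
From HB Require Import structures.
Require Import Defs.

(** The proof trades normal forms for universal properties, in both directions,
and so reduces the theorem to the construction of one homomorphism.

A group generated by subgroups S j is their internal free product as soon as
every family of homomorphisms on the S j extends to it: let each S j act on
the set of reduced words by multiplying on the left and extend these actions;
an element then sends the empty word to its own normal form, which is
therefore unique ([free_product_of_extends_homs]).  A free basis is recognized
in the same way ([free_with_basis_of_extends_maps]).  Conversely, a free
product has the extension property, by multiplying out normal forms
([free_product_extends_homs]).

It remains to extend to H a family of homomorphisms, with values in some group
P, given on the subgroups u G_a u^-1 `&` H, together with a map fZ : Z -> P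
([kurosh_extension]).  Write t_a x for the representative of the coset H x in
T a, and z_a x = t_a x * (t_a0 x)^-1, with fZ 1 = 1.  If g is in G_a then
t_a x * g * (t_a (x g))^-1 lies in u G_a u^-1 `&` H for the representative u
in D a of H x G_a, so it has a value f_(a,u) in P, and
  c_a x g = (fZ (z_a x))^-1 * f_(a,u) (t_a x * g * (t_a (x g))^-1)
            * fZ (z_a (x g))
is a cocycle of G_a with values in P.  These cocycles extend to a single
cocycle C of the free product G ([cocycle_extension]), which depends on x only
through H x, so that r = C 1 is a homomorphism on H.  To see that r extends
the given data it is enough to know that C 1 (t_a x) = fZ (z_a x).  The axioms
of a Kurosh system are what makes this true: they allow every t_a x to be
built from 1 by appending syllables while remaining among the representatives
([coset_rep_ind]), and the formula is preserved at each step because there the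
middle factor of c_a is f_(a,u) 1 = 1.

Replacing the values in P by the elements of G that they stand for, the same
decomposition of t_a0 x * g * (t_a0 (x g))^-1 shows that H is generated by the
proposed factors ([kurosh_generation]).

That Z is a set rather than a family matters: the same element z_a x may come
from several indices a.  The formula for C 1 (t_a x) mentions z_a x only as an
element of G, which is why no choice between these indices has to be made. *)

Set Implicit Arguments.
Unset Strict Implicit.
Unset Printing Implicit Defensive.

Local Open Scope classical_set_scope.
Local Open Scope group_scope.

(** * Subgroups and homomorphisms defined on them *)

Section Subgroups.
Variables (G : groupType) (K : set G).
Hypothesis hK : is_subgroup K.

Lemma subgroup1 : K 1.
Proof. by case: hK => /set_mem. Qed.

Lemma subgroupV x : K x -> K x^-1.
Proof. by move=> Kx; apply/set_mem/(group_closedV hK)/mem_set. Qed.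

Lemma subgroupM x y : K x -> K y -> K (x * y).
Proof.
by move=> Kx Ky; apply/set_mem/(group_closedM hK); apply/mem_set.
Qed.

End Subgroups.

Lemma is_subgroupI (G : groupType) (K : set G) :
  K 1 -> (forall x y, K x -> K y -> K (x * y^-1)) -> is_subgroup K.
Proof.
move=> K1 KV; split; first exact/mem_set.
by move=> x y /set_mem Kx /set_mem Ky; apply/mem_set/KV.
Qed.

Lemma conj_subgroupI (G : groupType) (u : G) (K H : set G) :
  is_subgroup K -> is_subgroup H -> is_subgroup (conj_subset u K `&` H).
Proof.
move=> hK hH; apply: is_subgroupI.
  by split; [exists 1; [exact: subgroup1|rewrite mulg1 mulgV]|exact: subgroup1].
move=> _ _ [[x Kx <-] Hx] [[y Ky <-] Hy]; split.
  exists (x * y^-1); first by apply: subgroupM => //; apply: subgroupV.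
  by rewrite !invgM !invgK !mulgA mulgVK.
by apply: subgroupM => //; apply: subgroupV.
Qed.

Lemma generated_subgroup (G : groupType) (Z : set G) :
  is_subgroup (generated Z).
Proof.
apply: is_subgroupI => [|x y Zx Zy] B [hB ZB]; first exact: subgroup1.
apply: subgroupM => //; first by apply: Zx; split.
by apply: subgroupV => //; apply: Zy; split.
Qed.

Lemma generated_sub (G : groupType) (Z K : set G) :
  is_subgroup K -> Z `<=` K -> generated Z `<=` K.
Proof. exact: smallest_sub. Qed.

(** Normal forms change in a controlled way only under multiplication by one
generator on the left, hence this asymmetric induction principle. *)
Lemma generated_ind (G : groupType) (Z N : set G) : N 1 ->
  (forall z g, Z z -> N g -> N (z * g) /\ N (z^-1 * g)) -> generated Z `<=` N.
Proof.
move=> N1 NZ g; pose M := [set g | forall n, N n -> N (g * n) /\ N (g^-1 * n)].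
suff /[apply] /(_ _ N1)[] : generated Z `<=` M by rewrite mulg1.
apply: generated_sub => [|z Zz n Nn]; last exact: NZ.
apply: is_subgroupI => [n Nn|x y Mx My n Nn]; first by rewrite invg1 mul1g.
rewrite invgF -!mulgA; split.
  by have [_ /Mx[]] := My _ Nn.
by have [_ /My[]] := Mx _ Nn.
Qed.

(** Homomorphisms are total functions constrained on a subgroup only; this
avoids turning each subgroup into a type. *)
Definition hom_on (G P : groupType) (K : set G) (f : G -> P) : Prop :=
  forall x y, K x -> K y -> f (x * y) = f x * f y.

Section HomOn.
Variables (G P : groupType) (K : set G) (f : G -> P).
Hypotheses (hK : is_subgroup K) (hf : hom_on K f).

Lemma hom_on1 : f 1 = 1.
Proof.
have := hf (subgroup1 hK) (subgroup1 hK); rewrite mulg1.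
by rewrite -{1}[f 1]mulg1 => /mulgI ->.
Qed.

Lemma hom_onV x : K x -> f x^-1 = (f x)^-1.
Proof.
move=> Kx; apply: esym; apply: mulg1_eq.
by rewrite -hf ?mulgV ?hom_on1//; apply: subgroupV.
Qed.

End HomOn.

Lemma hom_on_sub (G P : groupType) (K L : set G) (f : G -> P) :
  K `<=` L -> hom_on L f -> hom_on K f.
Proof. by move=> KL hf x y Kx Ky; apply: hf; apply: KL. Qed.

Lemma eq_hom_on_generated (G P : groupType) (Z : set G) (f g : G -> P) :
  hom_on (generated Z) f -> hom_on (generated Z) g ->
  (forall z, Z z -> f z = g z) -> forall x, generated Z x -> f x = g x.
Proof.
move=> hf hg fg x Zx; have hZ := generated_subgroup Z.
suff /(_ _ Zx)[] : generated Z `<=` [set x | generated Z x /\ f x = g x] by [].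
apply: generated_sub => [|z Zz]; last first.
  by split; [exact: sub_gen_smallest|exact: fg].
apply: is_subgroupI.
  by split; [exact: subgroup1|rewrite !(hom_on1 hZ)].
move=> y z [Zy fy] [Zz fz]; have ZVz := subgroupV hZ Zz.
split; first exact: (subgroupM hZ).
by rewrite hf// hg// !(hom_onV hZ)// fy fz.
Qed.

(** * The group of permutations of a type *)

(** The inverse is a field, so that the group operations need no choice. *)
Record perms (W : Type) := Perms {
  perms_fun :> W -> W;
  perms_inv : W -> W;
  perms_funK : cancel perms_fun perms_inv;
  perms_invK : cancel perms_inv perms_fun }.

HB.instance Definition _ (W : Type) := gen_eqMixin (perms W).
HB.instance Definition _ (W : Type) := gen_choiceMixin (perms W).

Section PermsGroup.
Variable W : Type.
Implicit Types p q r : perms W.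

Lemma permsP p q : (forall w, p w = q w) -> p = q.
Proof.
case: p q => [f f' fK f'K] [g g' gK g'K] /= /funext fg; subst g.
have f'g' : f' = g' by apply/funext => w; rewrite -[w in LHS]g'K fK.
by subst g'; congr Perms; apply: Prop_irrelevance.
Qed.

Definition perms_one : perms W :=
  @Perms W id id (fun=> erefl) (fun=> erefl).
Definition perms_mul p q : perms W :=
  Perms (can_comp (@perms_funK _ p) (@perms_funK _ q))
        (can_comp (@perms_invK _ q) (@perms_invK _ p)).
Definition perms_inverse p : perms W :=
  Perms (@perms_invK _ p) (@perms_funK _ p).

Fact perms_mulA : associative perms_mul.
Proof. by move=> p q r; apply: permsP. Qed.
Fact perms_mul1 : left_id perms_one perms_mul.
Proof. by move=> p; apply: permsP. Qed.
Fact perms_1mul : right_id perms_one perms_mul.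
Proof. by move=> p; apply: permsP. Qed.
Fact perms_mulV : left_inverse perms_one perms_inverse perms_mul.
Proof. by move=> p; apply: permsP => w /=; rewrite perms_funK. Qed.
Fact perms_Vmul : right_inverse perms_one perms_inverse perms_mul.
Proof. by move=> p; apply: permsP => w /=; rewrite perms_invK. Qed.

HB.instance Definition _ := isGroup.Build (perms W)
  perms_mulA perms_mul1 perms_1mul perms_mulV perms_Vmul.

Lemma permsM p q w : (p * q) w = p (q w).
Proof. by []. Qed.

End PermsGroup.

(** The choice of a permutation for each element of K is arbitrary outside K,
where [act] need not be invertible. *)
Lemma action_hom (G : groupType) (K : set G) (W : Type) (act : G -> W -> W) :
    is_subgroup K -> (forall w, act 1 w = w) ->
    (forall x y w, K x -> K y -> act (x * y) w = act x (act y w)) ->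
  exists2 f : G -> perms W,
    hom_on K f & forall x w, K x -> f x w = act x w.
Proof.
move=> hK act1 actM.
have mk x : {q : perms W | K x -> forall w, q w = act x w}.
  have [Kx|nKx] := pselect (K x); last by exists 1.
  have KVx := subgroupV hK Kx.
  have fK : cancel (act x) (act x^-1) by move=> w; rewrite -actM// mulVg.
  have gK : cancel (act x^-1) (act x) by move=> w; rewrite -actM// mulgV.
  by exists (Perms fK gK).
exists (fun x => sval (mk x)) => [x y Kx Ky|x w Kx]; last exact: (svalP (mk x)).
apply: permsP => w; rewrite permsM (svalP (mk x) Kx) (svalP (mk y) Ky).
by rewrite (svalP (mk _) (subgroupM hK Kx Ky)) actM.
Qed.

(** * Normal forms and the universal property of free products *)

Section Syllables.
Variables (G : groupType) (J : Type) (S : J -> set G).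
Hypothesis hS : forall j, is_subgroup (S j).
Implicit Types (w : seq (J * G)) (x y g : G) (i j : J).

(** The normal form of the product of x, in S j, and the value of the reduced
word w. *)
Definition mul_syllable j x w : seq (J * G) :=
  if x == 1 then w else
  if w is (k, y) :: w' then
    if `[< k = j >] then if x * y == 1 then w' else (j, x * y) :: w'
    else (j, x) :: w
  else [:: (j, x)].

Definition head_avoids j w : bool :=
  if w is p :: _ then `[< j <> p.1 >] else true.

Lemma reduced_cons j x w : reduced S ((j, x) :: w) =
  [&& x \in S j, x != 1, head_avoids j w & reduced S w].
Proof.
case: w => [|[k y] w]; first by rewrite /reduced /= !andbT.
rewrite /reduced; set a := fun p => _; set e := fun p q => _.
have shuffle b1 b2 b3 b4 b5 :
    ((b1 && b2) && b3) && (b4 && b5) = [&& b1, b2, b4 & b3 && b5].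
  by rewrite -!andbA; congr [&& _, _ & _]; rewrite andbCA.
exact: shuffle.
Qed.

Lemma mul_syllable_reduced j x w :
  S j x -> reduced S w -> reduced S (mul_syllable j x w).
Proof.
move=> Sx; rewrite /mul_syllable; case: eqP => [//|/eqP x1].
case: w => [_|[k y] w]; first by rewrite reduced_cons x1 mem_set.
case: asboolP => [->|kj] rw; last first.
  rewrite reduced_cons x1 rw mem_set//= andbT; apply/asboolP.
  by move=> /esym.
move: rw; rewrite reduced_cons => /and4P[/set_mem Sy y1 jw rw].
case: eqP => [//|/eqP xy1]; rewrite reduced_cons xy1 jw rw mem_set//.
exact: subgroupM.
Qed.

Lemma mul_syllable_cons j x w :
  reduced S ((j, x) :: w) -> mul_syllable j x w = (j, x) :: w.
Proof.
rewrite reduced_cons /mul_syllable => /and4P[_ /negPf-> + _].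
case: w => [//|[k y] w]; rewrite /head_avoids => /asboolP jk.
by case: asboolP => // /esym.
Qed.

(** This makes each S j act on the set of reduced words. *)
Lemma mul_syllableM j x y w : S j x -> S j y -> reduced S w ->
  mul_syllable j (x * y) w = mul_syllable j x (mul_syllable j y w).
Proof.
move=> Sx Sy rw; rewrite {3}/mul_syllable.
have [->|y1] := eqVneq y 1; first by rewrite mulg1.
have [->|x1] := eqVneq x 1.
  by rewrite mul1g /mul_syllable eqxx (negPf y1).
case: w rw => [_|[k z] w].
  by rewrite /mul_syllable (negPf x1)//; case: asboolP.
case: asboolP => [->|kj]; last first.
  by move=> _; rewrite /mul_syllable (negPf x1); do 2!case: asboolP => //.
rewrite reduced_cons => /and4P[Sz z1 jw rw].
case: eqP => [yz1|_].
  (* y cancels the first syllable of the word; its tail avoids j, so that x is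
     put in front of it *)
  rewrite [RHS]mul_syllable_cons; last by rewrite reduced_cons mem_set ?x1 ?jw.
  rewrite /mul_syllable; case: (asboolP (j = j)) => // _.
  rewrite -mulgA yz1 mulg1 (negPf x1); case: eqP => // xy1.
  by move/eqP: xy1; rewrite mulg_eq1 (mulg1_eq yz1) => /eqP->.
rewrite /mul_syllable (negPf x1); case: (asboolP (j = j)) => // _.
case: eqP => [xy1|_]; last by rewrite mulgA.
by rewrite mulgA xy1 mul1g (negPf z1).
Qed.

Lemma mul_syllable_hom (P : groupType) (f : J -> G -> P) j x w :
    (forall i, hom_on (S i) (f i)) -> S j x -> reduced S w ->
  \prod_(p <- mul_syllable j x w) f p.1 p.2
    = f j x * \prod_(p <- w) f p.1 p.2.
Proof.
move=> hf Sx; have f1 i : f i 1 = 1 by apply: hom_on1.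
rewrite /mul_syllable; case: eqP => [->|_]; first by rewrite f1 mul1g.
case: w => [_|[k y] w]; first by rewrite big_cons.
case: asboolP => [->|_]; last by rewrite big_cons.
rewrite reduced_cons => /and4P[/set_mem Sy _ _ _].
by case: eqP => [xy1|_]; rewrite !big_cons /= mulgA -hf// xy1 f1 mul1g.
Qed.

Lemma mul_syllable_prod j x w : S j x -> reduced S w ->
  \prod_(p <- mul_syllable j x w) p.2 = x * \prod_(p <- w) p.2.
Proof. exact: (@mul_syllable_hom G (fun=> id)). Qed.

End Syllables.

Lemma reduced_prod_sub (G : groupType) (J : Type) (S : J -> set G) (K : set G)
    (w : seq (J * G)) : is_subgroup K -> (forall j, S j `<=` K) ->
  reduced S w -> K (\prod_(p <- w) p.2).
Proof.
move=> hK SK; elim: w => [_|[j x] w IHw].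
  by rewrite big_nil; apply: subgroup1.
rewrite reduced_cons big_cons => /and4P[/set_mem Sx _ _ /IHw Kw].
by apply: subgroupM => //; apply: SK Sx.
Qed.

Section FreeProduct.
Variables (G : groupType) (J : Type) (K : set G) (S : J -> set G).

(** The existence half of the universal property of the coproduct; uniqueness
of [h] on K follows when K is generated by the S j. *)
Definition extends_homs : Prop := forall (P : groupType) (f : J -> G -> P),
  (forall j, hom_on (S j) (f j)) ->
  exists2 h : G -> P, hom_on K h & forall j x, S j x -> h x = f j x.

(** The argument of van der Waerden: once the actions of the S j on the reduced
words extend to K, an element of K with normal form w sends the empty word to
w. *)
Lemma free_product_of_extends_homs :
    is_subgroup K -> (forall j, is_subgroup (S j) /\ S j `<=` K) ->
    K `<=` generated (\bigcup_j S j) -> extends_homs -> free_product K S.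
Proof.
move=> hK hSK Kgen ext; have hS j := (hSK j).1; have SK j := (hSK j).2.
split=> // g Kg.
have [w [rw wg]] : exists w, normal_form S g w.
  move: g {Kg}(Kgen g Kg); apply: generated_ind.
    by exists [::]; rewrite /normal_form big_nil.
  have mulS j x g : S j x -> (exists w, normal_form S g w) ->
      exists w, normal_form S (x * g) w.
    move=> Sx [w [rw <-]]; exists (mul_syllable j x w).
    split; first exact: (mul_syllable_reduced hS).
    exact: (mul_syllable_prod hS).
  move=> x g [j _ Sx] Ng; split; first exact: (mulS j).
  exact: (mulS j _ _ (subgroupV (hS j) Sx) Ng).
exists w; split=> // v [rv vg].
pose W := {w : seq (J * G) | reduced S w}.
pose act j x (w : W) : W := insubd w (mul_syllable j x (val w)).
have actE j x w0 : S j x -> val (act j x w0) = mul_syllable j x (val w0).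
  move=> Sx; rewrite insubdK//.
  exact: (mul_syllable_reduced hS Sx (valP w0)).
have hom j := action_hom (act := act j) (hS j).
have {hom} hom j : exists f : G -> perms W,
    hom_on (S j) f /\ forall x w, S j x -> f x w = act j x w.
  have [|x y w0 Sx Sy|f hf fE] := hom j; last by exists f.
    move=> w0; apply: val_inj; rewrite actE /mul_syllable ?eqxx//.
    exact: subgroup1.
  apply: val_inj; rewrite !actE//; last exact: subgroupM.
  exact: mul_syllableM (valP w0).
have /choice[f /all_and2[hf fE]] := hom.
have [h hh hE] := ext _ f hf.
pose nil : W := exist _ [::] isT.
have readoff u : reduced S u -> val (h (\prod_(p <- u) p.2) nil) = u.
  elim: u => [_|[j x] u IHu]; first by rewrite big_nil (hom_on1 hK).
  move=> rju; have := rju; rewrite reduced_cons big_cons.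
  move=> /and4P[/set_mem Sx _ _ ru].
  rewrite hh; [|exact: (SK j)|exact: reduced_prod_sub ru].
  by rewrite permsM (hE j)// fE// actE// IHu// (mul_syllable_cons rju).
by rewrite -(readoff w)// -(readoff v)// wg vg.
Qed.

Hypothesis hfree : free_product K S.

Let hK : is_subgroup K. Proof. by case: hfree. Qed.
Let hS j : is_subgroup (S j). Proof. by case: hfree => _ /(_ j)[]. Qed.
Let SK j : S j `<=` K. Proof. by case: hfree => _ /(_ j)[]. Qed.

Lemma free_product_nf g : K g -> exists w, normal_form S g w.
Proof. by case: hfree => _ _ /[apply] -[w []]; exists w. Qed.

Lemma normal_form_inj g v w :
  normal_form S g v -> normal_form S g w -> v = w.
Proof.
move=> gv gw; case: hfree => _ _ /(_ g)[|u [_ uP]]; last first.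
  by rewrite -(uP v)// -(uP w).
by case: gv => rv <-; apply: reduced_prod_sub rv.
Qed.

Lemma free_product_ind (N : set G) : N 1 ->
  (forall j x g, S j x -> K g -> N g -> N (x * g)) -> K `<=` N.
Proof.
move=> N1 NS _ /free_product_nf[w [+ <-]].
elim: w => [_|[j x] w IHw]; first by rewrite big_nil.
rewrite reduced_cons big_cons => /and4P[/set_mem Sx _ _ rw].
by apply: (NS j) => //; [exact: reduced_prod_sub rw|exact: IHw].
Qed.

(** Multiplying by a syllable on the left alters a normal form in its first
syllable only; hence the product of the values of the syllables is
multiplicative in its left argument when this is a syllable, and then in
general by induction. *)
Lemma free_product_extends_homs : extends_homs.
Proof.
move=> P f hf.
have nf g : exists w, K g -> normal_form S g w.
  have [Kg|nKg] := pselect (K g); last by exists [::].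
  by have [w gw] := free_product_nf Kg; exists w.
have {nf} /choice[nf nfP] := nf.
pose h g := \prod_(p <- nf g) f p.1 p.2.
have h1 : h 1 = 1.
  rewrite /h (normal_form_inj (w := [::]) (nfP _ (subgroup1 hK))) ?big_nil//.
  by rewrite /normal_form big_nil.
have hSM j x g : S j x -> K g -> h (x * g) = f j x * h g.
  move=> Sx Kg; have [rg gE] := nfP _ Kg; have Kx := SK Sx.
  rewrite /h -(mul_syllable_hom hS)//; congr (\prod_(p <- _) _).
  apply: normal_form_inj (nfP _ (subgroupM hK Kx Kg)) _; split.
    exact: mul_syllable_reduced.
  by rewrite (mul_syllable_prod hS)// gE.
exists h => [x y|j x Sx]; last first.
  by rewrite -[x]mulg1 (hSM j)// ?h1 ?mulg1//; apply: subgroup1.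
move=> Kx Ky; move: x Kx; apply: free_product_ind; first by rewrite h1 !mul1g.
move=> j x g Sx Kg IHg; rewrite -mulgA !(hSM _ _ _ Sx)//; last first.
  exact: (subgroupM hK).
by rewrite IHg mulgA.
Qed.

End FreeProduct.

(** * Free words and the universal property of free groups *)

Section FreeWords.
Variables (G : groupType) (Z : set G).
Implicit Types (w : seq (G * bool)) (l : G * bool).

Definition opp_letter l : G * bool := (l.1, ~~ l.2).

Definition mul_letter l w : seq (G * bool) :=
  if w is k :: w' then if k == opp_letter l then w' else l :: w else [:: l].

Lemma free_word_cons l w : free_word Z (l :: w) =
  [&& l.1 \in Z, (if w is k :: _ then k != opp_letter l else true)
    & free_word Z w].
Proof.
case: w => [|k w]; first by rewrite /free_word /= !andbT.
exact: (etrans (andbACA _ _ _ _) (esym (andbA _ _ _))).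
Qed.

Lemma mul_letter_cons l w : free_word Z (l :: w) -> mul_letter l w = l :: w.
Proof.
by rewrite free_word_cons => /and3P[_]; case: w => //= k w /negPf->.
Qed.

Lemma mul_letter_free l w :
  Z l.1 -> free_word Z w -> free_word Z (mul_letter l w).
Proof.
move=> Zl; case: w => [|k w] fw.
  by rewrite /mul_letter free_word_cons mem_set.
rewrite /mul_letter; case: eqP => [_|/eqP kl].
  by move: fw; rewrite free_word_cons => /and3P[_ _].
by rewrite free_word_cons mem_set// kl.
Qed.

Lemma opp_letterK : involutive opp_letter.
Proof. by case=> z b; rewrite /opp_letter negbK. Qed.

Lemma mul_letterK l w :
  free_word Z w -> mul_letter l (mul_letter (opp_letter l) w) = w.
Proof.
case: w => [|k w] fw; first by rewrite /= eqxx.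
rewrite {2}/mul_letter opp_letterK.
case: eqP => [<-|_]; last by rewrite /= eqxx.
exact: mul_letter_cons.
Qed.

Lemma mul_letter_value l w : free_word_value (mul_letter l w) =
  (if l.2 then l.1 else l.1^-1) * free_word_value w.
Proof.
rewrite /free_word_value; case: w => [|k w] /=; first by rewrite big_cons.
case: eqP => [->|_]; rewrite !big_cons//=.
by case: l.2; rewrite ?mulKg ?mulVKg.
Qed.

(** The same argument as for free products, with each element of Z acting on the
free words by left multiplication. *)
Lemma free_with_basis_of_extends_maps :
  (forall (P : groupType) (f : G -> P), exists2 h : G -> P,
    hom_on (generated Z) h & forall z, Z z -> h z = f z) ->
  free_with_basis (generated Z) Z.
Proof.
move=> ext; have hZ := generated_subgroup Z.
have ZZ : Z `<=` generated Z by apply: sub_gen_smallest.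
split=> // g Zg.
have [w [fw wg]] : exists w, free_word Z w /\ free_word_value w = g.
  move: g Zg; apply: generated_ind.
    by exists [::]; rewrite /free_word_value big_nil.
  move=> z _ Zz [w [fw <-]]; split.
    exists (mul_letter (z, true) w).
    by rewrite mul_letter_value mul_letter_free.
  exists (mul_letter (z, false) w).
  by rewrite mul_letter_value mul_letter_free.
exists w; split=> // v [fv vg].
pose W := {w : seq (G * bool) | free_word Z w}.
pose act l (w : W) : W := insubd w (mul_letter l (val w)).
have actE l (w0 : W) : Z l.1 -> val (act l w0) = mul_letter l (val w0).
  by move=> Zl; rewrite insubdK//; apply: mul_letter_free (valP w0).
have actK z b : Z z -> cancel (act (z, b)) (act (z, ~~ b)).
  move=> Zz w0; apply: val_inj; rewrite !actE//.
  by have := mul_letterK (z, ~~ b) (valP w0); rewrite /opp_letter /= negbK.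
have perm z : exists q : perms W, Z z ->
    forall w : W, q w = act (z, true) w /\ q^-1 w = act (z, false) w.
  have [Zz|nZz] := pselect (Z z); last by exists 1.
  by exists (Perms (actK z true Zz) (actK z false Zz)).
have [f fE] := choice perm.
have [h hh hE] := ext _ f.
pose nil : W := exist _ [::] isT.
have readoff u : free_word Z u ->
    generated Z (free_word_value u) /\ val (h (free_word_value u) nil) = u.
  elim: u => [_|[z b] u IHu].
    rewrite /free_word_value big_nil (hom_on1 hZ hh).
    by split=> //; apply: subgroup1.
  move=> fzu; have := fzu; rewrite free_word_cons.
  move=> /and3P[/set_mem/= Zz _ /IHu[Zu uE]].
  rewrite /free_word_value big_cons -/(free_word_value u) /=.
  have Zz' := ZZ _ Zz; have ZVz := subgroupV hZ Zz'.
  split; first by apply: (subgroupM hZ) => //; case: (b).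
  rewrite hh//; last by case: (b).
  rewrite permsM -[RHS]mul_letter_cons// -[in RHS]uE -actE//; congr (val _).
  have [hT hF] := fE _ Zz (h (free_word_value u) nil).
  by case: (b); rewrite ?(hom_onV hZ)// hE// ?hT ?hF.
by rewrite -(readoff w fw).2 -(readoff v fv).2 wg vg.
Qed.

End FreeWords.

(** * Extending cocycles from the factors to a free product *)

(** A cocycle c j of S j is an action of S j on P * G that commutes with the
left translations of P and covers right translation by inverses on G:
g sends (p, x) to (p * c j x g^-1, x * g^-1).  Actions extend to the free
product, and the extended action keeps this shape. *)
Lemma cocycle_extension (G : groupType) (J : Type) (S : J -> set G)
    (hG : free_product [set: G] S) (P : groupType) (c : J -> G -> G -> P) :
    (forall j x g g', S j g -> S j g' ->
      c j x (g * g') = c j x g * c j (x * g) g') ->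
  exists2 C : G -> G -> P,
    forall x g g', C x (g * g') = C x g * C (x * g) g' &
    forall j x g, S j g -> C x g = c j x g.
Proof.
move=> cM; case: (hG) => hT hS _.
have c1 j x : c j x 1 = 1.
  have S1 := subgroup1 (hS j).1.
  by have := cM j x 1 1 S1 S1; rewrite !mulg1 -{1}[c j x 1]mulg1 => /mulgI ->.
pose act j g (w : P * G) := (w.1 * c j w.2 g^-1, w.2 * g^-1).
have hom j : exists f : G -> perms (P * G),
    hom_on (S j) f /\ forall g w, S j g -> f g w = act j g w.
  have [[p x]|g g' [p x] Sg Sg'|f] := action_hom (act := act j) (hS j).1.
  - by rewrite /act/= invg1 c1 !mulg1.
  - by rewrite /act/= invgM cM ?mulgA//; apply: (subgroupV (hS j).1).
  - by exists f.
have /choice[f /all_and2[hf fE]] := hom.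
have [h hh hE] := free_product_extends_homs hG hf.
have hC g p x : h g (p, x) = (p * (h g (1, x)).1, x * g^-1).
  suff hCg : [set: G] `<=` [set g | forall p x,
      h g (p, x) = (p * (h g (1, x)).1, x * g^-1)] by exact: hCg.
  apply: (free_product_ind hG) => [{}p {}x|j y {}g Sy _ IHg {}p {}x].
    by rewrite (hom_on1 hT hh) invg1 !mulg1.
  rewrite hh// !permsM IHg [in RHS]IHg (hE j)// !fE// /act/= mul1g.
  by rewrite invgM !mulgA.
exists (fun x g => (h g^-1 (1, x)).1) => [x g g'|j x g Sg].
  by rewrite invgM hh// permsM (hC g^-1) hC/= invgK mul1g.
have SVg := subgroupV (hS j).1 Sg.
by rewrite (hE j)// fE// /act/= invgK mul1g.
Qed.

(** * Cosets, double cosets and Kurosh systems *)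

Lemma rep_block (G : groupType) (blocks : set (set G)) (R X : set G) :
  representatives blocks R -> blocks X -> R (rep R X) /\ X (rep R X).
Proof.
move=> hR /hR[r [[Rr Xr] _]].
by apply: (xgetI 1 (x := r) (P := R `&` X)).
Qed.

Lemma rep_fix (G : groupType) (blocks : set (set G)) (R X : set G) r :
  representatives blocks R -> blocks X -> R r -> X r -> rep R X = r.
Proof.
move=> hR bX Rr Xr; have [Rs Xs] := rep_block hR bX.
by have [q [_ qP]] := hR X bX; rewrite -(qP (rep R X))// -(qP r).
Qed.

Lemma right_coset_mul (G : groupType) (H : set G) h x :
  is_subgroup H -> H h -> right_coset H (h * x) = right_coset H x.
Proof.
move=> hH Hh; apply/seteqP; split => [_ [k Hk <-]|_ [k Hk <-]].
  by exists (k * h); [exact: subgroupM|rewrite mulgA].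
exists (k * h^-1); last by rewrite mulgA mulgVK.
by apply: subgroupM => //; apply: subgroupV.
Qed.

Lemma double_coset_mul (G : groupType) (H K : set G) h x k :
  is_subgroup H -> is_subgroup K -> H h -> K k ->
  double_coset H (h * x * k) K = double_coset H x K.
Proof.
move=> hH hK Hh Kk; apply/seteqP; split => _ [h' Hh' [k' Kk' <-]].
  exists (h' * h); first exact: subgroupM.
  by exists (k * k'); [exact: subgroupM|rewrite !mulgA].
exists (h' * h^-1); first by apply: subgroupM => //; apply: subgroupV.
exists (k^-1 * k'); first by apply: subgroupM => //; apply: subgroupV.
by rewrite !mulgA mulgVK mulgK.
Qed.

Section Kurosh.
Variables (G : groupType) (A : Type) (Gf : A -> set G).
Hypothesis hG : free_product [set: G] Gf.
Variables (H : set G) (D T : A -> set G).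
Hypotheses (hH : is_subgroup H) (hK : kurosh_system Gf H D T).
Variable a0 : A.
Implicit Types (a b : A) (x g h k v : G).

Let hGf a : is_subgroup (Gf a). Proof. by case: hG => _ /(_ a)[]. Qed.

Definition coset_rep a x : G := rep (T a) (right_coset H x).
Definition dcoset_rep a x : G := rep (D a) (double_coset H x (Gf a)).

Lemma coset_repM a h x : H h -> coset_rep a (h * x) = coset_rep a x.
Proof. by move=> Hh; rewrite /coset_rep right_coset_mul. Qed.

Lemma dcoset_repM a h x k :
  H h -> Gf a k -> dcoset_rep a (h * x * k) = dcoset_rep a x.
Proof. by move=> Hh Kk; rewrite /dcoset_rep double_coset_mul. Qed.

Lemma dcoset_repMl a h x : H h -> dcoset_rep a (h * x) = dcoset_rep a x.
Proof. by move=> Hh; rewrite -[h * x]mulg1 dcoset_repM//; apply: subgroup1. Qed.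

Lemma dcoset_repMr a x k : Gf a k -> dcoset_rep a (x * k) = dcoset_rep a x.
Proof.
by move=> Gk; rewrite -[x in LHS]mul1g dcoset_repM//; apply: subgroup1.
Qed.

Lemma coset_repP a x : exists2 h, H h & coset_rep a x = h * x.
Proof.
have [|_ [h Hh E]] := rep_block (kurosh_T hK a) (X := right_coset H x).
  by exists x.
by exists h.
Qed.

Lemma coset_rep1 a h : H h -> coset_rep a h = 1.
Proof.
move=> Hh; rewrite -[h]mulg1 coset_repM// /coset_rep -[RHS](kurosh_T1 hK a).
congr (rep _ _); apply/seteqP; split => [_ [k Hk <-]|k Hk].
  by rewrite mulg1.
by exists k; rewrite ?mulg1.
Qed.

Lemma coset_rep_comp a b x : coset_rep a (coset_rep b x) = coset_rep a x.
Proof. by have [h Hh ->] := coset_repP b x; rewrite coset_repM. Qed.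

Lemma dcoset_rep_in a x :
  D a (dcoset_rep a x) /\ double_coset H x (Gf a) (dcoset_rep a x).
Proof.
by apply: (rep_block (@kurosh_D _ _ _ _ _ _ hK a)); exists x.
Qed.

Lemma double_coset_rep a x :
  double_coset H (dcoset_rep a x) (Gf a) = double_coset H x (Gf a).
Proof.
by have [_ [h Hh [k Gk <-]]] := dcoset_rep_in a x; rewrite double_coset_mul.
Qed.

Lemma dcoset_rep_fix a v : D a v -> dcoset_rep a v = v.
Proof.
move=> Dv; apply: (rep_fix (@kurosh_D _ _ _ _ _ _ hK a)) => //.
  by exists v.
exists 1; first exact: subgroup1.
by exists 1; [exact: subgroup1|rewrite mul1g mulg1].
Qed.

Lemma coset_rep_fix a v : D a v -> coset_rep a v = v.
Proof. by move=> /dcoset_rep_fix Dv; apply/esym/(kurosh_i hK); apply/esym. Qed.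

(** This is [kurosh_iii] for the coset of x, which lies in the double coset of
the representative of H x G_a. *)
Lemma coset_rep_dcoset a x :
  exists2 k, Gf a k & coset_rep a x = dcoset_rep a x * k.
Proof.
have [|||k Gk kE] := kurosh_iii hK (a := a) (g := dcoset_rep a x)
    (Hi := right_coset H x); last by exists k.
- by exists x.
- rewrite double_coset_rep => _ [h Hh <-]; exists h => //.
  by exists 1; [exact: subgroup1|rewrite mulg1].
- by rewrite double_coset_rep.
Qed.

(** The hypothesis on w says that v does not end in the syllable a. *)
Lemma normal_form_rcons a w v k :
    normal_form Gf v w -> (forall w' y, w <> rcons w' (a, y)) ->
  Gf a k -> k != 1 -> normal_form Gf (v * k) (rcons w (a, k)).
Proof.
move=> [/andP[aw sw] <-] wa Gk k1; split; last by rewrite big_rcons.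
rewrite /reduced all_rcons aw /= k1 mem_set//=.
case/lastP: w wa sw {aw} => [//|w [b y]] wa.
have ba : `[< (b, y).1 <> (a, k).1 >].
  by apply/asboolP => /= ba; apply: (wa w y); rewrite ba.
case: w {wa} => [_|p w]; first by rewrite /= ba.
rewrite /sorted !rcons_cons [path _ _ (rcons (rcons _ _) _)]rcons_path.
by rewrite last_rcons => ->.
Qed.

(** By [kurosh_iii], t_a x is v k with v in D a and k in G_a, so it is enough to
reach every v in D a.  This is done by induction on the syllable length of v.
If v is not 1, it ends in some syllable b by [kurosh_ii], so it equals t_b v by
[kurosh_iv], and therefore is v' k' with v' in D b and k' in G_b.  By
[kurosh_ii] again v' does not end in b, so v' is shorter than v. *)
Lemma coset_rep_ind (N : set G) : N 1 ->
    (forall a v k, D a v -> N v -> Gf a k -> coset_rep a (v * k) = v * k ->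
      N (v * k)) ->
  forall a x, N (coset_rep a x).
Proof.
move=> N1 NM.
suff ND n a v w : D a v -> normal_form Gf v w -> size w <= n -> N v.
  move=> a x; have [w wP] := free_product_nf hG (I : [set: G] (dcoset_rep a x)).
  have [Dv _] := dcoset_rep_in a x; have := ND _ _ _ _ Dv wP (leqnn _).
  have := coset_rep_comp a a x; have [k Gk ->] := coset_rep_dcoset a x.
  by move=> kE Nv; apply: (NM a).
elim: n => [|n IHn] in a v w *.
  by rewrite leqn0 => _ [_ <-] /eqP/size0nil->; rewrite big_nil.
move=> Dv wP wn; have [->//|v1] := eqVneq v 1.
have vE := dcoset_rep_fix Dv.
have := kurosh_ii hK a v; rewrite -/(dcoset_rep a v) vE.
case=> [v1'|[b ba [w1 [x xP]]]]; first by rewrite v1' eqxx in v1.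
have bE : coset_rep b v = v.
  apply: (kurosh_iv hK (a := a)); last by exists w1, x.
    by apply/eqP; rewrite eq_sym.
  by rewrite -{1}vE.
have [k Gk kE] := coset_rep_dcoset b v; rewrite bE in kE.
have [Du _] := dcoset_rep_in b v.
rewrite kE; apply: (NM b) => //; last by rewrite -kE.
have [w2 w2P] := free_product_nf hG (I : [set: G] (dcoset_rep b v)).
apply: (IHn b _ w2) => //.
(* the representative of a double coset modulo G_b does not end in b *)
have w2b w' y : w2 <> rcons w' (b, y).
  move=> w2E; have := kurosh_ii hK b v; rewrite -/(dcoset_rep b v).
  case=> [u1|[c cb [w3 [z w3P]]]].
    have nil1 : normal_form Gf 1 [::] by split; rewrite ?big_nil.
    move: w2P; rewrite u1 => /(normal_form_inj hG nil1).
    by rewrite w2E; case: (w').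
  by have := normal_form_inj hG w2P w3P; rewrite w2E => /rcons_inj[_ /esym].
(* otherwise v, which ends in b, would be v', which does not *)
have k1 : k != 1.
  apply/eqP => k1; rewrite k1 mulg1 in kE.
  by apply: (w2b w1 x); apply: (normal_form_inj hG w2P); rewrite -kE.
have := normal_form_rcons w2P w2b Gk k1; rewrite -kE => vP.
by rewrite -ltnS -(size_rcons w2 (b, k)) (normal_form_inj hG vP wP).
Qed.

(** The element z of the index (H x, a), parametrized by x rather than by its
coset. *)
Definition transition a x : G := coset_rep a x * (coset_rep a0 x)^-1.

Lemma transition_sub a x : H (transition a x).
Proof.
have [h Hh hE] := coset_repP a x; have [h' Hh' hE'] := coset_repP a0 x.
rewrite /transition hE hE' invgM mulgA mulgK.
by apply: subgroupM => //; apply: subgroupV.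
Qed.

Lemma kurosh_Z_transition a x :
  transition a x != 1 -> kurosh_Z H T a0 (transition a x).
Proof.
move=> /eqP z1; split=> //; exists (right_coset H x); first by exists x.
by exists a.
Qed.

Lemma kurosh_ZP z : kurosh_Z H T a0 z -> exists a x, z = transition a x.
Proof. by move=> [_ [_ [x _ <-] [a ->]]]; exists a, x. Qed.

(** Both representatives lie in u G_a, as x and x g are in the same double
coset, and the product lies in H since t_a y and y differ by an element of H on
the left. *)
Lemma syllable_conj a x g (u := dcoset_rep a x) : Gf a g ->
  (conj_subset u (Gf a) `&` H)
    (coset_rep a x * g * (coset_rep a (x * g))^-1).
Proof.
move=> Gg; split; last first.
  have [h Hh ->] := coset_repP a x; have [h' Hh' ->] := coset_repP a (x * g).
  rewrite invgM !mulgA -(mulgA h x g) mulgK.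
  by apply: subgroupM => //; apply: subgroupV.
have [k Gk ->] := coset_rep_dcoset a x.
have [k' Gk' ->] := coset_rep_dcoset a (x * g).
rewrite dcoset_repMr// -/u; exists (k * g * k'^-1); last first.
  by rewrite invgM !mulgA.
by do !apply: subgroupM => //; apply: subgroupV.
Qed.

(** The index of the factor to which the syllables of a at x contribute. *)
Definition dcoset_index a x : {a : A & set_type (D a)} :=
  existT _ a (SigSub (mem_set (dcoset_rep_in a x).1)).

Lemma dcoset_indexE a x y :
  dcoset_rep a x = dcoset_rep a y -> dcoset_index a x = dcoset_index a y.
Proof. by move=> xy; congr existT; apply: val_inj. Qed.

Lemma dcoset_index_val a (u : set_type (D a)) :
  dcoset_index a (val u) = existT _ a u.
Proof.
by congr existT; apply: val_inj; apply/dcoset_rep_fix/set_mem/(valP u).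
Qed.

(** On x = u k u^-1 in H the cocycle gives
C 1 x = C 1 u * C u k * (C 1 u)^-1, because u k = x u is in the coset of u; as
C 1 u = fZ (z_a u) and C u k is f_(a,u) x conjugated by fZ (z_a u), this is
f_(a,u) x.  For z = z_a x, the equality t_a x = z * t_a0 x gives
fZ (z_a x) = C 1 z * fZ (z_a0 x), where z_a0 x = 1. *)
Lemma kurosh_extension (P : groupType)
    (f : {a : A & set_type (D a)} -> G -> P) (fZ : G -> P) : fZ 1 = 1 ->
    (forall a (u : set_type (D a)),
      hom_on (conj_subset (val u) (Gf a) `&` H) (f (existT _ a u))) ->
  exists2 r : G -> P, hom_on H r &
    (forall a (u : set_type (D a)) x,
      (conj_subset (val u) (Gf a) `&` H) x -> r x = f (existT _ a u) x) /\
    (forall z, kurosh_Z H T a0 z -> r z = fZ z).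
Proof.
move=> fZ1 hf.
pose zeta a x := fZ (transition a x).
pose c a x g := (zeta a x)^-1 *
  f (dcoset_index a x) (coset_rep a x * g * (coset_rep a (x * g))^-1) *
  zeta a (x * g).
have zetaM a h x : H h -> zeta a (h * x) = zeta a x.
  by move=> Hh; rewrite /zeta /transition !coset_repM.
have hfx a x : hom_on (conj_subset (dcoset_rep a x) (Gf a) `&` H)
    (f (dcoset_index a x)) by exact: (hf a (projT2 (dcoset_index a x))).
have cM a x g g' : Gf a g -> Gf a g' ->
    c a x (g * g') = c a x g * c a (x * g) g'.
  move=> Gg Gg'; rewrite /c -(dcoset_indexE (dcoset_repMr x Gg)).
  rewrite -!mulgA mulVKg; congr (_ * _); rewrite !mulgA; congr (_ * _).
  rewrite -hfx; first by rewrite !mulgA mulgVK.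
    by rewrite dcoset_repMr//; apply: syllable_conj.
  exact: syllable_conj.
have [C CM Cc] := cocycle_extension hG cM.
have [hT _ _] := hG.
have C1 x : C x 1 = 1.
  by have := CM x 1 1; rewrite !mulg1 -{1}[C x 1]mulg1 => /mulgI ->.
(* C depends on x only through its coset, because each c a does *)
have CH h x g : H h -> C (h * x) g = C x g.
  move=> Hh; suff CHx : [set: G] `<=` [set g | forall x, C (h * x) g = C x g].
    exact: CHx.
  apply: (free_product_ind hG) => [{}x|a y {}g Gy _ IHg {}x].
    by rewrite !C1.
  rewrite !CM -!mulgA IHg; congr (_ * _); rewrite !(Cc a)// /c.
  rewrite -(mulgA h) !(zetaM _ _ _ Hh) !(coset_repM _ _ Hh).
  by rewrite (dcoset_indexE (dcoset_repMl a x Hh)).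
have Crep a x : C 1 (coset_rep a x) = zeta a x.
  (* stated without a, the formula can be carried from one factor to another *)
  have -> : zeta a x = fZ (coset_rep a x * (coset_rep a0 (coset_rep a x))^-1).
    by rewrite coset_rep_comp.
  move: a x.
  apply: (coset_rep_ind
    (N := [set v | C 1 v = fZ (v * (coset_rep a0 v)^-1)]))
    => /= [|a v k Dv IHv Gk vkE].
    by rewrite C1 coset_rep1 ?invg1 ?mulg1//; apply: subgroup1.
  rewrite CM IHv mul1g (Cc a)// /c vkE (coset_rep_fix Dv) mulgV.
  rewrite /zeta /transition vkE (coset_rep_fix Dv) -!mulgA mulVKg.
  by rewrite (hom_on1 _ (hfx a v)) ?mul1g//; apply: conj_subgroupI.
exists (C 1) => [h h' Hh _|].
  by rewrite CM mul1g -[X in C X h']mulg1 CH.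
split=> [a u x [[k Gk xE] Hx]|z Zz].
  have Du : D a (val u) by apply/set_mem/(valP u).
  have uE := coset_rep_fix Du.
  have : C 1 (x * val u) = C 1 (val u * k) by rewrite -xE mulgVK.
  have Cu : C 1 (val u) = zeta a (val u) by rewrite -{1}uE Crep.
  have Cx : C x (val u) = C 1 (val u) by rewrite -[X in C X]mulg1 CH.
  rewrite !CM !mul1g Cx Cu => E.
  have ukE : val u * k = x * val u by rewrite -xE mulgVK.
  apply: (mulIg (zeta a (val u))); rewrite E (Cc a)// /c ukE zetaM//.
  by rewrite coset_repM// uE xE dcoset_index_val -!mulgA mulVKg.
have [a [x zE]] := kurosh_ZP Zz.
have Hz : H z by rewrite zE; apply: transition_sub.
have := Crep a x; rewrite -[coset_rep a x](mulgVK (coset_rep a0 x)).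
rewrite -/(transition a x) -zE CM mul1g.
rewrite -[X in C X (coset_rep a0 x)]mulg1 CH// Crep.
by rewrite {1}/zeta {1}/transition mulgV fZ1 mulg1 /zeta -zE.
Qed.

Lemma kurosh_Z_sub : generated (kurosh_Z H T a0) `<=` H.
Proof.
apply: generated_sub => // z /kurosh_ZP[a [x ->]]; exact: transition_sub.
Qed.

(** For h in H the element t_a0 1 * h * (t_a0 h)^-1 is h itself.  Splitting h
into syllables and changing from t_a0 to t_a and back at each syllable of a
factors it into elements of the conjugates and of Z. *)
Lemma kurosh_generation :
  H `<=` generated (\bigcup_j
    kurosh_factor Gf H (D := D) (generated (kurosh_Z H T a0)) j).
Proof.
set K := generated _; have hKg : is_subgroup K by apply: generated_subgroup.
have SK j x :
    kurosh_factor Gf H (D := D) (generated (kurosh_Z H T a0)) j x -> K x.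
  by move=> Sx; apply: sub_gen_smallest; exists j.
have Kz a x : K (transition a x).
  have [->|/kurosh_Z_transition Zz] := eqVneq (transition a x) 1.
    exact: subgroup1.
  by apply: (SK None); apply: sub_gen_smallest.
have Kg g x : K (coset_rep a0 x * g * (coset_rep a0 (x * g))^-1).
  suff Kgx : [set: G] `<=` [set g | forall x,
      K (coset_rep a0 x * g * (coset_rep a0 (x * g))^-1)] by exact: Kgx.
  apply: (free_product_ind hG) => [{}x|a y {}g Gy _ IHg {}x].
    by rewrite !mulg1 mulgV; apply: subgroup1.
  have -> : coset_rep a0 x * (y * g) * (coset_rep a0 (x * (y * g)))^-1 =
      (transition a x)^-1 *
      (coset_rep a x * y * (coset_rep a (x * y))^-1) *
      transition a (x * y) *
      (coset_rep a0 (x * y) * g * (coset_rep a0 (x * y * g))^-1).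
    by rewrite /transition invgM invgK !mulgA !mulgVK.
  have Kxy := SK (Some (dcoset_index a x)) _ (syllable_conj x Gy).
  apply: (subgroupM hKg); last exact: IHg.
  apply: (subgroupM hKg) (Kz _ _).
  by apply: (subgroupM hKg) Kxy; apply: (subgroupV hKg).
move=> h Hh; have := Kg h 1.
by rewrite !mul1g !coset_rep1//; [rewrite mul1g invg1 mulg1|exact: subgroup1].
Qed.

End Kurosh.

(** * The subgroup theorem *)

Theorem theorem4p3p5 (G : groupType) (A : Type) (Gf : A -> set G)
    (hG : free_product [set: G] Gf)
    (H : set G) (hH : is_subgroup H)
    (D T : A -> set G) (hK : kurosh_system Gf H D T)
    (a0 : A) :
  let Z := kurosh_Z H T a0 in
  let F := generated Z in
  free_product H (kurosh_factor Gf H (D := D) F) /\ free_with_basis F Z.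
Proof.
move=> Z F; have FH : F `<=` H by move=> x; apply: (kurosh_Z_sub hH hK).
have hGf a : is_subgroup (Gf a) by case: hG => _ /(_ a)[].
split.
  apply: free_product_of_extends_homs => //.
  - case=> [[a u]|]; split=> //; last exact: generated_subgroup.
      exact: conj_subgroupI.
    by move=> x [].
  - by move=> x; apply: (kurosh_generation hG hH hK).
  move=> P f hf.
  have [||r hr [rf rZ]] := kurosh_extension hG hH hK a0
      (f := fun p => f (Some p)) (fZ := f None).
  - by apply: hom_on1 (hf None); apply: generated_subgroup.
  - by move=> a u; apply: (hf (Some (existT _ a u))).
  exists r => // -[[a u]|] x; first exact: rf.
  (* on F two homomorphisms that agree on Z coincide *)
  by apply: eq_hom_on_generated => //; [exact: hom_on_sub hr|exact: (hf None)].
apply: free_with_basis_of_extends_maps => P f.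
(* the extension needs the value 1 at 1, which is not in Z *)
pose f1 z := if z == 1 then 1 else f z.
have [||r hr [_ rZ]] := kurosh_extension hG hH hK a0
    (f := fun _ _ => 1 : P) (fZ := f1).
- by rewrite /f1 eqxx.
- by move=> a u x y _ _; rewrite mulg1.
exists r; first exact: hom_on_sub hr.
by move=> z Zz; rewrite rZ// /f1; case: eqP => // z1; case: Zz.
Qed.
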